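(* Let $G$ be a finite group and let $\mathfrak{X}(G)=(G,\{c_g\mid g\in G\})$ be the thin homogeneous coherent configuration defined by $G$. Let $\mathfrak{W}$ be the set of $\sim$ equivalence classes of weights on $\mathfrak{X}(G)$ having no zero entry, let $\mathfrak{W}_H$ be the set of $\sim_H$ equivalence classes of H-weights on $\mathfrak{X}(G)$ having no zero entry, and let $H^2(G,\mathbb{C}^\times)$ be the $2$-cohomology group of $G$. Then there exist natural bijections between the three sets $\mathfrak{W}$, $\mathfrak{W}_H$ and $H^2(G,\mathbb{C}^\times)$; namely, the maps $$\Phi:H^2(G,\mathbb{C}^\times)\to\mathfrak{W},\quad \Phi([\alpha])=[W_\alpha],\qquad \Psi:\mathfrak{W}_H\to\mathfrak{W},\quad \Psi([W]_H)=[W]$$ are well defined and bijective, where $[\alpha]$, $[W]$, $[W]_H$ denote the class of $\alpha$ in $H^2(G,\mathbb{C}^\times)$, the $\sim$ class of a weight $W$, and the $\sim_H$ class of an H-weight $W$.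
   Context: Let $G$ be a finite group and $M_G(\mathbb{C})$ the algebra of complex matrices with rows and columns indexed by $G$. For $g\in G$ put $c_g=\{(x,y)\in G\times G\mid xg=y\}$, $C=\{c_g\mid g\in G\}$, $\mathfrak{X}(G)=(G,C)$, and let $c_g^*=\{(y,x)\mid (x,y)\in c_g\}=c_{g^{-1}}$. Let $A_g\in M_G(\mathbb{C})$ be the $0/1$ matrix with $(A_g)_{x,y}=1$ iff $(x,y)\in c_g$. For $W\in M_G(\mathbb{C})$ let $\mathrm{spt}(W)=\{(x,y)\mid W_{xy}\neq 0\}$ and $A_g^W=A_g\circ W$ (entrywise product). A matrix $W$ is a weight on $\mathfrak{X}(G)$ if: (W1) $\mathrm{spt}(W)$ is a union of members of $C$, and for $d\in C$, $d\subset\mathrm{spt}(W)$ implies $d^*\subset\mathrm{spt}(W)$; (W2) $W_{xx}\neq 0$ for all $x\in G$; (W3) the linear span $\bigoplus_{g\in G}\mathbb{C}A_g^W$ is an algebra (closed under matrix multiplication). It is an H-weight if moreover (W4) $W$ is hermitian, $|W_{xy}|\in\{0,1\}$ for all $x,y$, and $W_{xx}=1$ for all $x$. $W$ has no zero entry if $\mathrm{spt}(W)=G\times G$. Equivalence: let $\mathrm{Aut}(\mathfrak{X}(G))$ be the group of permutations $\sigma$ of $G$ with $c^\sigma=c$ for all $c\in C$, where $c^\sigma=\{(x^\sigma,y^\sigma)\mid(x,y)\in c\}$, and let $P_\sigma$ be the permutation matrix of $\sigma$. Weights $W,W'$ are equivalent, $W\sim W'$, if there exist $a_x\in\mathbb{C}^\times$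 ($x\in G$), $\gamma(g)\in\mathbb{C}^\times$ ($g\in G$) and $\sigma\in\mathrm{Aut}(\mathfrak{X}(G))$ with $$W'=\mathrm{diag}(a_x\mid x\in G)^{-1}P_\sigma^{-1}\Big(\sum_{g\in G}\gamma(g)A_g^W\Big)P_\sigma\,\mathrm{diag}(a_x\mid x\in G).$$ H-weights $W,W'$ are H-equivalent, $W\sim_H W'$, if this holds with $|a_x|=|\gamma(g)|=1$ for all $x,g$ and $\gamma(g^{-1})=\gamma(g)^{-1}$ for all $g$. A factor set ($2$-cocycle) is a function $\alpha:G\times G\to\mathbb{C}^\times$ with $\alpha(g,h)\alpha(gh,k)=\alpha(g,hk)\alpha(h,k)$ for all $g,h,k\in G$ (trivial action). Factor sets $\alpha,\beta$ are equivalent if there is $\gamma:G\to\mathbb{C}^\times$ with $\beta(g,h)=\gamma(g)\gamma(h)\gamma(gh)^{-1}\alpha(g,h)$ for all $g,h$. $H^2(G,\mathbb{C}^\times)$ is the group of factor sets modulo this equivalence (i.e. modulo $2$-coboundaries). For a factor set $\alpha$, $W_\alpha\in M_G(\mathbb{C})$ is defined by $(W_\alpha)_{xy}=\alpha(x,x^{-1}y)$. *)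

(* Defs.v *)
From mathcomp Require Import all_boot all_order all_fingroup all_algebra.
From mathcomp Require Import complex.
From mathcomp Require Import classical_sets functions reals.

Set Implicit Arguments.
Unset Strict Implicit.
Unset Printing Implicit Defensive.

Import Order.TTheory GRing.Theory Num.Theory.

Local Open Scope ring_scope.
Local Open Scope complex_scope.

(* Rows and columns are indexed by G through the enumeration of G; entries are
   accessed with [entry] and matrices are built with [mxG], so the choice of
   enumeration never matters. *)
Notation MG R G := 'M[(complex R)]_#|G|.

Section Weights.
Context (R : realType) (G : finGroupType).
Local Notation C := R[i].

Definition entry (W : MG R G) (x y : G) : C := W (enum_rank x) (enum_rank y).
Definition mxG (f : G -> G -> C) : MG R G :=
  \matrix_(i, j) f (enum_val i) (enum_val j).

Definition cell (g : G) : {set G * G} := [set p | (p.1 * g)%g == p.2].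
Definition cells : {set {set G * G}} := [set cell g | g in [set: G]].
Definition converse (c : {set G * G}) : {set G * G} := [set (p.2, p.1) | p in c].

Definition adj (g : G) : MG R G := mxG (fun x y => ((x, y) \in cell g)%:R).
Definition spt (W : MG R G) : {set G * G} := [set p | entry W p.1 p.2 != 0].
Definition adjW (W : MG R G) (g : G) : MG R G := map2_mx *%R (adj g) W.

Definition adj_span (W : MG R G) : {vspace (MG R G)} := (\sum_(g : G) <[adjW W g]>)%VS.

Definition is_weight (W : MG R G) : Prop :=
  [/\ (exists2 D : {set {set G * G}}, D \subset cells & spt W = finset.cover D)
      /\ (forall d, d \in cells -> d \subset spt W -> converse d \subset spt W),
      (forall x, entry W x x != 0)
    & (forall M N : MG R G, M \in adj_span W -> N \in adj_span W ->
         M *m N \in adj_span W)].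

Definition is_Hweight (W : MG R G) : Prop :=
  is_weight W /\
  [/\ W \is hermsymmx,
      (forall x y, `|entry W x y| = 0 \/ `|entry W x y| = 1)
    & (forall x, entry W x x = 1)].

Definition no_zero_entry (W : MG R G) : Prop := spt W = [set: G * G].

Definition conf_aut : {set {perm G}} :=
  [set s : {perm G} |
    [forall c in cells, [set (s p.1, s p.2) | p in (c : {set G * G})] == c]].

(* Same convention as [perm_mx]: the entry (x, x^s) is 1. *)
Definition permG_mx (s : {perm G}) : MG R G := mxG (fun x y => (s x == y)%:R).
Definition diagG_mx (a : G -> C) : MG R G := diag_mx (\row_i a (enum_val i)).

Definition transform (a gamma : G -> C) (s : {perm G}) (W : MG R G) : MG R G :=
  invmx (diagG_mx a) *m invmx (permG_mx s) *m
    (\sum_(g : G) gamma g *: adjW W g) *m permG_mx s *m diagG_mx a.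

Definition weight_equiv (W W' : MG R G) : Prop :=
  exists (a gamma : G -> C) (s : {perm G}),
    [/\ (forall x, a x != 0), (forall g, gamma g != 0), s \in conf_aut
      & W' = transform a gamma s W].

Definition Hweight_equiv (W W' : MG R G) : Prop :=
  exists (a gamma : G -> C) (s : {perm G}),
    [/\ (forall x, `|a x| = 1), (forall g, `|gamma g| = 1),
        (forall g, gamma g^-1%g = (gamma g)^-1), s \in conf_aut
      & W' = transform a gamma s W].

Definition factor_set (alpha : G -> G -> C) : Prop :=
  (forall g h, alpha g h != 0) /\
  (forall g h k,
     alpha g h * alpha (g * h)%g k = alpha g (h * k)%g * alpha h k).

Definition factor_set_equiv (alpha beta : G -> G -> C) : Prop :=
  exists gamma : G -> C, (forall g, gamma g != 0) /\
    (forall g h,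
       beta g h = gamma g * gamma h * (gamma (g * h)%g)^-1 * alpha g h).

Definition factor_set_mx (alpha : G -> G -> C) : MG R G :=
  mxG (fun x y => alpha x (x^-1 * y)%g).

End Weights.

Definition eqclass (T : Type) (D : set T) (r : T -> T -> Prop) (x : T) : set T :=
  [set y | D y /\ r x y]%classic.

Section Classes.
Context (R : realType) (G : finGroupType).
Local Open Scope classical_set_scope.

Definition factor_class (alpha : G -> G -> R[i]) : set (G -> G -> R[i]) :=
  eqclass (@factor_set R G) (@factor_set_equiv R G) alpha.
Definition weight_class (W : MG R G) : set (MG R G) :=
  eqclass (@is_weight R G) (@weight_equiv R G) W.
Definition Hweight_class (W : MG R G) : set (MG R G) :=
  eqclass (@is_Hweight R G) (@Hweight_equiv R G) W.

(* The underlying set of H^2 with coefficients in the nonzero complex numbers. *)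
Definition H2 : set (set (G -> G -> R[i])) :=
  factor_class @` [set alpha | factor_set alpha].
Definition weight_classes : set (set (MG R G)) :=
  weight_class @` [set W | is_weight W /\ no_zero_entry W].
Definition Hweight_classes : set (set (MG R G)) :=
  Hweight_class @` [set W | is_Hweight W /\ no_zero_entry W].

End Classes.

Arguments H2 R G : clear implicits.
Arguments weight_classes R G : clear implicits.
Arguments Hweight_classes R G : clear implicits.

(* Main.v *)
(* Let W be a weight without zero entry.  Closure of the span under products
   means that A_g^W A_h^W is a multiple of A_gh^W, i.e. that
   W(x,xg) W(xg,xgh) / W(x,xgh) does not depend on x; as a function of (g,h) this
   ratio is a factor set.  It is unchanged by diagonal conjugation and by left
   translation, and rescaling by gamma multiplies it by the coboundary of gamma.
   The factor set of W_alpha is alpha, and W is diagonally conjugate (by its row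
   at 1) to the matrix of its own factor set; hence Phi is a bijection.
   For Psi, every factor set is equivalent to one with values of norm 1 and with
   alpha(g,g^-1) = 1, whose matrix is an H-weight; and an equivalence between
   H-weights becomes an H-equivalence after dividing a and gamma by their norms. *)

Require Import Defs.
From mathcomp Require Import all_boot all_order all_fingroup all_algebra.
From mathcomp Require Import complex.
From mathcomp Require Import classical_sets functions reals.
From mathcomp Require Import ring.

Set Implicit Arguments.
Unset Strict Implicit.
Unset Printing Implicit Defensive.

Import Order.TTheory GRing.Theory Num.Theory.

(** * Maps between sets of equivalence classes *)

Section Quotients.
Local Open Scope classical_set_scope.

Lemma eqclass_eq (T : Type) (D : set T) (r : T -> T -> Prop)
    (rS : forall x y, r x y -> r y x)
    (rT : forall x y z, r x y -> r y z -> r x z) (x y : T) :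
  r x y -> eqclass D r x = eqclass D r y.
Proof.
move=> xy; apply/seteqP; split=> z [Dz rz]; split=> //.
  exact: rT (rS _ _ xy) rz.
exact: rT xy rz.
Qed.

(** Classes are formed inside [D], but only those of points of [E] are compared. A class may leave
    [E], which is why [f_homo] ranges over [D]; [f_mono] gives injectivity and [f_surj]
    surjectivity. *)
Lemma eqclass_bij (T T' : Type) (D E : set T) (D' E' : set T')
    (r : T -> T -> Prop) (r' : T' -> T' -> Prop) (f : T -> T')
    (rR : forall x, r x x) (rS : forall x y, r x y -> r y x)
    (rT : forall x y z, r x y -> r y z -> r x z)
    (r'R : forall x, r' x x) (r'S : forall x y, r' x y -> r' y x)
    (r'T : forall x y z, r' x y -> r' y z -> r' x z)
    (ED : E `<=` D) (E'D' : E' `<=` D') (fE : forall x, E x -> E' (f x))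
    (f_homo : forall x y, D x -> D y -> r x y -> r' (f x) (f y))
    (f_mono : forall x y, E x -> E y -> r' (f x) (f y) -> r x y)
    (f_surj : forall y, E' y -> exists2 x, E x & r' (f x) y) :
  exists2 F : set T -> set T',
    forall x, E x -> F (eqclass D r x) = eqclass D' r' (f x)
    & set_bij (eqclass D r @` E) (eqclass D' r' @` E') F.
Proof.
(* Saturating the image of the class under [r'] avoids choosing a representative. *)
pose F (S : set T) : set T' := [set y | D' y /\ exists2 x, S x & r' (f x) y].
have FE x : E x -> F (eqclass D r x) = eqclass D' r' (f x).
  move=> Ex; apply/seteqP; split=> y.
    move=> [Dy [z [Dz xz] zy]]; split=> //.
    by apply: r'T zy; apply: f_homo => //; apply: ED.
  by move=> [Dy xy]; split=> //; exists x => //; split; [apply: ED|apply: rR].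
exists F => //; split.
- by move=> _ [x Ex <-]; rewrite /= FE //; exists (f x) => //; apply: fE.
- move=> _ _ /set_mem[x Ex <-] /set_mem[y Ey <-]; rewrite !FE // => xy.
  apply: eqclass_eq => //; apply: f_mono => //; apply: r'S.
  suff: eqclass D' r' (f y) (f x) by case.
  by rewrite -xy; split; [apply: E'D'; apply: fE|apply: r'R].
- move=> _ [y Ey <-]; have [x Ex xy] := f_surj _ Ey.
  by exists (eqclass D r x); [exists x|rewrite FE //; apply: eqclass_eq].
Qed.

End Quotients.

Section Weights.
Context (R : realType) (G : finGroupType).
Local Open Scope ring_scope.
Local Notation C := (R[i]%C).
Implicit Types (W V M N : MG R G) (x y z g h k t : G) (a b gamma : G -> C).

(** * Matrix calculus indexed by group elements *)

Lemma entry_mxG (f : G -> G -> C) x y : entry (mxG f) x y = f x y.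
Proof. by rewrite /entry mxE !enum_rankK. Qed.

Lemma entry_inj M N : (forall x y, entry M x y = entry N x y) -> M = N.
Proof.
move=> MN; apply/matrixP => i j; move: (MN (enum_val i) (enum_val j)).
by rewrite /entry !enum_valK.
Qed.

Lemma entry_mulmx M N x y :
  entry (M *m N) x y = \sum_z entry M x z * entry N z y.
Proof.
rewrite /entry mxE (reindex_onto enum_rank enum_val) /=; last first.
  by move=> i _; rewrite enum_valK.
by apply: eq_bigl => z; rewrite enum_rankK eqxx.
Qed.

Lemma entry_1mx x y : entry (1%:M : MG R G) x y = (x == y)%:R.
Proof. by rewrite /entry mxE (inj_eq enum_rank_inj). Qed.

Lemma entry_diagG_mx a x y : entry (diagG_mx a) x y = a x *+ (x == y).
Proof. by rewrite /entry !mxE enum_rankK (inj_eq enum_rank_inj). Qed.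

Lemma invmx_uniq (n : nat) (A B : 'M[C]_n) : A *m B = 1%:M -> invmx A = B.
Proof.
move=> AB; have [uA _] := mulmx1_unit AB.
by rewrite -[RHS]mul1mx -(mulVmx uA) -mulmxA AB mulmx1.
Qed.

Lemma entry_mulmx_diagG a M x y : entry (M *m diagG_mx a) x y = entry M x y * a y.
Proof.
rewrite entry_mulmx (bigD1 y) //= big1 => [|z zy].
  by rewrite entry_diagG_mx eqxx addr0.
by rewrite entry_diagG_mx (negPf zy) mulr0.
Qed.

Lemma entry_diagG_mulmx a M x y : entry (diagG_mx a *m M) x y = a x * entry M x y.
Proof.
rewrite entry_mulmx (bigD1 x) //= big1 => [|z zx].
  by rewrite entry_diagG_mx eqxx addr0.
by rewrite entry_diagG_mx eq_sym (negPf zx) mul0r.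
Qed.

Lemma entry_mulmx_permG (s : {perm G}) M x y :
  entry (M *m permG_mx R s) x y = entry M x ((s^-1)%g y).
Proof.
rewrite entry_mulmx (bigD1 ((s^-1)%g y)) //= big1 => [|z zy].
  by rewrite entry_mxG permKV eqxx mulr1 addr0.
by rewrite entry_mxG (canF_eq (permK s)) (negPf zy) mulr0.
Qed.

Lemma entry_permG_mulmx (s : {perm G}) M x y :
  entry (permG_mx R s *m M) x y = entry M (s x) y.
Proof.
rewrite entry_mulmx (bigD1 (s x)) //= big1 => [|z zx].
  by rewrite entry_mxG eqxx mul1r addr0.
by rewrite entry_mxG eq_sym (negPf zx) mul0r.
Qed.

Lemma invmx_diagG_mx a : (forall x, a x != 0) ->
  invmx (diagG_mx a) = diagG_mx (fun x => (a x)^-1).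
Proof.
move=> a0; apply: invmx_uniq; apply: entry_inj => x y.
rewrite entry_diagG_mulmx entry_diagG_mx entry_1mx.
by case: eqP => _; rewrite ?mulr1n ?divff ?mulr0n ?mulr0.
Qed.

Lemma invmx_permG_mx (s : {perm G}) : invmx (permG_mx R s) = permG_mx R s^-1.
Proof.
apply: invmx_uniq; apply: entry_inj => x y.
by rewrite entry_permG_mulmx entry_mxG entry_1mx permK.
Qed.

Lemma entry_adjW W g x y :
  entry (adjW W g) x y = ((x * g)%g == y)%:R * entry W x y.
Proof. by rewrite /entry !mxE !enum_rankK inE. Qed.

Lemma entry_sum_adjW (c : G -> C) W x y :
  entry (\sum_g c g *: adjW W g) x y = c (x^-1 * y)%g * entry W x y.
Proof.
transitivity (\sum_g c g * entry (adjW W g) x y).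
  by rewrite /entry summxE; apply: eq_bigr => g _; rewrite mxE.
rewrite (bigD1 (x^-1 * y)%g) //= big1 => [|g gxy].
  by rewrite entry_adjW mulKVg eqxx mul1r addr0.
rewrite entry_adjW; case: eqP => [e|_]; last by rewrite mul0r mulr0.
by rewrite -e mulKg eqxx in gxy.
Qed.

(** The cells partition the pairs, and [(x, y)] lies in the cell of [x^-1 * y]; so membership in the
    span means a factor depending on [x^-1 * y] only. *)
Lemma adj_spanP W M :
  M \in adj_span W <->
  exists c : G -> C, forall x y, entry M x y = c (x^-1 * y)%g * entry W x y.
Proof.
split=> [/memv_sumP[vs vsP ->]|[c cP]].
  have /fin_all_exists[c cP] g : exists c, vs g = c *: adjW W g.
    by have /vlineP[c ->] := vsP g isT; exists c.
  exists c => x y; rewrite -entry_sum_adjW.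
  by congr (entry _ x y); apply: eq_bigr => g _.
have ->: M = \sum_g c g *: adjW W g.
  by apply: entry_inj => x y; rewrite entry_sum_adjW.
apply/memv_sumP; exists (fun g => c g *: adjW W g) => // g _.
by apply: memvZ; apply: memv_line.
Qed.

Lemma no_zero_entryP W :
  no_zero_entry W <-> forall x y, entry W x y != 0.
Proof.
split=> [/setP sW x y|W0]; first by have := sW (x, y); rewrite !inE.
by apply/setP => -[x y]; rewrite !inE W0.
Qed.

(** * Weights without zero entry and their factor sets *)

Definition weight_factor W g h : C :=
  entry W 1%g g * entry W g (g * h)%g / entry W 1%g (g * h)%g.

Lemma weight_factorP W (nzW : no_zero_entry W) (wW : is_weight W) g h x :
  entry W x (x * g)%g * entry W (x * g)%g (x * g * h)%g
    = weight_factor W g h * entry W x (x * g * h)%g.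
Proof.
have W0 := (no_zero_entryP W).1 nzW; have [_ _ mulW] := wW.
have adjWin k : adjW W k \in adj_span W.
  apply/adj_spanP; exists (fun l => (k == l)%:R) => u v.
  by rewrite entry_adjW -[k == _](inj_eq (mulgI u)) mulKVg.
have /adj_spanP[c cP] := mulW _ _ (adjWin g) (adjWin h).
have cE u : entry W u (u * g)%g * entry W (u * g)%g (u * g * h)%g
    = c (g * h)%g * entry W u (u * g * h)%g.
  (* In the product of the matrices for [g] and [h], the only nonzero term at this entry passes
     through [u * g]. *)
  have := cP u (u * g * h)%g; rewrite -mulgA mulKg => <-.
  rewrite entry_mulmx (bigD1 (u * g)%g) //= big1 => [|z zug].
    by rewrite !entry_adjW mulgA !eqxx !mul1r addr0.
  by rewrite entry_adjW eq_sym (negPf zug) !mul0r.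
rewrite cE /weight_factor; have := cE 1%g; rewrite !mul1g => ->.
by rewrite mulfK.
Qed.

Lemma factor_set_weight W (nzW : no_zero_entry W) (beta : G -> G -> C) :
  (forall g h x, entry W x (x * g)%g * entry W (x * g)%g (x * g * h)%g
     = beta g h * entry W x (x * g * h)%g) -> is_weight W.
Proof.
move=> betaP; split.
- split=> [|d _ _]; last by rewrite nzW finset.subsetT.
  exists (cells G) => //; rewrite nzW; apply/setP => -[x y]; rewrite inE.
  apply/esym/bigcupP; exists (cell (x^-1 * y)%g); last by rewrite inE mulKVg.
  by apply/imsetP; exists (x^-1 * y)%g.
- by move=> x; apply: (no_zero_entryP W).1.
move=> M N /adj_spanP[c cP] /adj_spanP[d dP]; apply/adj_spanP.
(* Coefficients multiply by the convolution twisted by [beta], as in a twisted group algebra. *)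
exists (fun k => \sum_g c g * d (g^-1 * k)%g * beta g (g^-1 * k)%g) => x y.
rewrite entry_mulmx (reindex_inj (mulgI x)) mulr_suml; apply: eq_bigr => g _ /=.
rewrite cP dP mulKg.
have := betaP g (g^-1 * (x^-1 * y))%g x.
rewrite invMg !mulgA mulgK mulgV mul1g => e.
by rewrite mulrACA e mulrA.
Qed.

(** The product of the entries along the path 1, g, gh, ghk is reduced in two ways. The step [e4] is
    based at [g] instead of 1, so independence of the base point is essential. *)
Lemma factor_set_weight_factor W :
  no_zero_entry W -> is_weight W -> factor_set (weight_factor W).
Proof.
move=> nzW wW; have W0 := (no_zero_entryP W).1 nzW.
split=> [g h|g h k]; first by rewrite !mulf_neq0 // invr_eq0.
have e := weight_factorP nzW wW.
apply: (mulIf (W0 1%g (g * h * k)%g)).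
have e1 := e g h 1%g; have e2 := e (g * h)%g k 1%g.
have e3 := e g (h * k)%g 1%g; have e4 := e h k g.
rewrite !mul1g mulgA in e1 e2 e3.
rewrite -mulrA -e2 mulrA -e1 -mulrA e4 mulrCA e3 mulrA.
by rewrite [_ * weight_factor _ g _]mulrC.
Qed.

Lemma no_zero_factor_set_mx (alpha : G -> G -> C) :
  factor_set alpha -> no_zero_entry (factor_set_mx alpha).
Proof. by move=> [a0 _]; apply/no_zero_entryP => x y; rewrite entry_mxG. Qed.

(** This is the cocycle identity for the triple [(x, g, h)]. *)
Lemma factor_set_mxP (alpha : G -> G -> C) (fa : factor_set alpha) g h x :
  entry (factor_set_mx alpha) x (x * g)%g
    * entry (factor_set_mx alpha) (x * g)%g (x * g * h)%g
  = alpha g h * entry (factor_set_mx alpha) x (x * g * h)%g.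
Proof.
rewrite !entry_mxG !mulKg -(mulgA x g h) mulKg.
by rewrite fa.2 mulrC.
Qed.

Lemma is_weight_factor_set_mx (alpha : G -> G -> C) :
  factor_set alpha -> is_weight (factor_set_mx alpha).
Proof.
move=> fa; apply: (@factor_set_weight _ _ alpha).
  exact: no_zero_factor_set_mx.
exact: factor_set_mxP.
Qed.

Lemma weight_factor_factor_set_mx (alpha : G -> G -> C)
    (fa : factor_set alpha) g h :
  weight_factor (factor_set_mx alpha) g h = alpha g h.
Proof.
have := factor_set_mxP fa g h 1%g; rewrite !mul1g /weight_factor => ->.
by rewrite mulfK //; apply: (no_zero_entryP _).1 (no_zero_factor_set_mx fa) _ _.
Qed.

(** * Equivalence of weights in terms of entries *)

(* The entrywise form of equivalence: an automorphism of the thin configuration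
   is a left translation, and [t] is the translation part of its inverse. *)
Definition rescaling (a gamma : G -> C) (t : G) W W' : Prop :=
  forall x y, entry W' x y =
    (a x)^-1 * a y * gamma (x^-1 * y)%g * entry W (t * x)%g (t * y)%g.

(** The pair [(1, x)] lies in the cell of [x], hence so does [(s 1, s x)]. *)
Lemma conf_aut_lmul (s : {perm G}) :
  s \in conf_aut G -> forall x, s x = (s 1 * x)%g.
Proof.
rewrite inE => /forall_inP sP x.
have /eqP sx: [set (s p.1, s p.2) | p in cell x] == cell x.
  by apply: sP; apply/imsetP; exists x.
have : (s 1%g, s x) \in cell x.
  by rewrite -sx; apply/imsetP; exists (1%g, x); rewrite // inE mul1g.
by rewrite inE => /eqP.
Qed.

Lemma lmul_conf_aut t : perm (mulgI t) \in conf_aut G.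
Proof.
rewrite inE; apply/forall_inP => _ /imsetP[g _ ->]; apply/eqP/setP => -[x y].
apply/imsetP/idP => [[[u v] /[!inE] /= /eqP <- [-> ->]]|].
  by rewrite !permE mulgA.
rewrite inE /= => /eqP <-; exists ((t^-1 * x)%g, (t^-1 * (x * g))%g).
  by rewrite inE /= mulgA.
by rewrite /= !permE !mulKVg.
Qed.

(** Conjugation by the permutation matrix moves [(x, y)] to its preimage under [s], a left translate
    with the same [x^-1 * y]; so the argument of [gamma] does not change. *)
Lemma rescaling_transform a gamma (s : {perm G}) W :
  (forall x, a x != 0) -> s \in conf_aut G ->
  rescaling a gamma (s 1)^-1%g W (transform a gamma s W).
Proof.
move=> a0 /conf_aut_lmul sE x y.
have sV z : (s^-1)%g z = ((s 1)^-1 * z)%g.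
  by apply: (@perm_inj _ s); rewrite permKV sE mulKVg.
rewrite /transform invmx_diagG_mx // invmx_permG_mx -!mulmxA.
rewrite entry_diagG_mulmx entry_permG_mulmx mulmxA entry_mulmx_diagG.
rewrite entry_mulmx_permG entry_sum_adjW !sV.
by rewrite invMg !mulgA mulgKV [_ * a y]mulrC !mulrA.
Qed.

Lemma rescaling_inj a gamma t W V V' :
  rescaling a gamma t W V -> rescaling a gamma t W V' -> V = V'.
Proof. by move=> h h'; apply: entry_inj => x y; rewrite h h'. Qed.

Lemma transform_rescaling a gamma t W V : (forall x, a x != 0) ->
  rescaling a gamma t W V -> V = transform a gamma (perm (mulgI t^-1%g)) W.
Proof.
move=> a0 /rescaling_inj; apply.
have := rescaling_transform gamma W a0 (lmul_conf_aut t^-1).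
by rewrite permE mulg1 invgK.
Qed.

Lemma weight_equivP W V : weight_equiv W V <->
  exists a gamma t, [/\ forall x, a x != 0, forall g, gamma g != 0
    & rescaling a gamma t W V].
Proof.
split=> [[a [gamma [s [a0 g0 sc ->]]]]|[a [gamma [t [a0 g0 r]]]]].
  by exists a, gamma, (s 1)^-1%g; split=> //; apply: rescaling_transform.
exists a, gamma, (perm (mulgI t^-1%g)); split=> //; first exact: lmul_conf_aut.
exact: transform_rescaling.
Qed.

Lemma norm1_neq0 (c : C) : `|c| = 1 -> c != 0.
Proof. by move=> c1; rewrite -normr_eq0 c1 oner_neq0. Qed.

Lemma Hweight_equivP W V : Hweight_equiv W V <->
  exists a gamma t, [/\ forall x, `|a x| = 1, forall g, `|gamma g| = 1,
    forall g, gamma g^-1%g = (gamma g)^-1 & rescaling a gamma t W V].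
Proof.
split=> [[a [gamma [s [a1 g1 gV sc ->]]]]|[a [gamma [t [a1 g1 gV r]]]]].
  exists a, gamma, (s 1)^-1%g; split=> //; apply: rescaling_transform => // x.
  exact: norm1_neq0.
exists a, gamma, (perm (mulgI t^-1%g)); split=> //; first exact: lmul_conf_aut.
by apply: transform_rescaling => // x; apply: norm1_neq0.
Qed.

(** * Reflexivity, symmetry and transitivity of the equivalences *)

Lemma rescaling_refl W : rescaling (fun=> 1) (fun=> 1) 1%g W W.
Proof. by move=> x y; rewrite !mul1g invr1 !mul1r. Qed.

Lemma rescaling_sym a gamma t W V :
  (forall x, a x != 0) -> (forall g, gamma g != 0) -> rescaling a gamma t W V ->
  rescaling (fun x => (a (t^-1 * x)%g)^-1) (fun g => (gamma g)^-1) t^-1%g V W.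
Proof.
move=> a0 g0 r x y; rewrite r !mulKVg invMg invgK !mulgA mulgK.
have := a0 (t^-1 * x)%g; have := a0 (t^-1 * y)%g; have := g0 (x^-1 * y)%g.
move: (a _) (a _) (gamma _) (entry _ _ _) => p q c w c0 q0 p0.
by field; rewrite c0 q0 p0.
Qed.

Lemma rescaling_trans a gamma t b delta u W V U :
  rescaling a gamma t W V -> rescaling b delta u V U ->
  rescaling (fun x => b x * a (u * x)%g) (fun g => delta g * gamma g) (t * u)%g W U.
Proof.
move=> r1 r2 x y; rewrite r2 r1 invMg !mulgA mulgKV invfM.
by ring.
Qed.

Lemma weight_equiv_refl W : weight_equiv W W.
Proof.
apply/weight_equivP; exists (fun=> 1), (fun=> 1), 1%g.
by split=> [x|g|]; rewrite ?oner_neq0 //; apply: rescaling_refl.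
Qed.

Lemma weight_equiv_sym W V : weight_equiv W V -> weight_equiv V W.
Proof.
move=> /weight_equivP[a [gamma [t [a0 g0 r]]]]; apply/weight_equivP.
do 3!eexists; split; last exact: rescaling_sym r.
  by move=> x; rewrite invr_eq0.
by move=> g; rewrite invr_eq0.
Qed.

Lemma weight_equiv_trans W V U :
  weight_equiv W V -> weight_equiv V U -> weight_equiv W U.
Proof.
move=> /weight_equivP[a [gamma [t [a0 g0 r]]]].
move=> /weight_equivP[b [delta [u [b0 d0 r']]]]; apply/weight_equivP.
do 3!eexists; split; last exact: rescaling_trans r r'.
  by move=> x; rewrite mulf_neq0.
by move=> g; rewrite mulf_neq0.
Qed.

Lemma Hweight_equiv_refl W : Hweight_equiv W W.
Proof.
apply/Hweight_equivP; exists (fun=> 1), (fun=> 1), 1%g.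
by split=> [x|g|g|]; rewrite ?normr1 ?invr1 //; apply: rescaling_refl.
Qed.

Lemma Hweight_equiv_sym W V : Hweight_equiv W V -> Hweight_equiv V W.
Proof.
move=> /Hweight_equivP[a [gamma [t [a1 g1 gV r]]]]; apply/Hweight_equivP.
do 3!eexists; split; last apply: rescaling_sym r.
- by move=> x; rewrite normfV a1 invr1.
- by move=> g; rewrite normfV g1 invr1.
- by move=> g /=; rewrite gV.
- by move=> x; apply: norm1_neq0.
- by move=> x; apply: norm1_neq0.
Qed.

Lemma Hweight_equiv_trans W V U :
  Hweight_equiv W V -> Hweight_equiv V U -> Hweight_equiv W U.
Proof.
move=> /Hweight_equivP[a [gamma [t [a1 g1 gV r]]]].
move=> /Hweight_equivP[b [delta [u [b1 d1 dV r']]]]; apply/Hweight_equivP.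
do 3!eexists; split; last exact: rescaling_trans r r'.
- by move=> x; rewrite normrM a1 b1 mulr1.
- by move=> g; rewrite normrM g1 d1 mulr1.
- by move=> g /=; rewrite gV dV invfM.
Qed.

Lemma Hweight_equiv_weight_equiv W V : Hweight_equiv W V -> weight_equiv W V.
Proof.
move=> /Hweight_equivP[a [gamma [t [a1 g1 _ r]]]]; apply/weight_equivP.
by exists a, gamma, t; split=> // x; apply: norm1_neq0.
Qed.

(** * Equivalence of factor sets against equivalence of weights *)

Implicit Types alpha beta : G -> G -> C.

Lemma factor_set_equiv_refl alpha : factor_set_equiv alpha alpha.
Proof.
by exists (fun=> 1); split=> [g|g h]; rewrite ?oner_neq0 // invr1 !mul1r.
Qed.

Lemma factor_set_equiv_sym alpha beta :
  factor_set_equiv alpha beta -> factor_set_equiv beta alpha.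
Proof.
move=> [gamma [g0 e]]; exists (fun g => (gamma g)^-1).
split=> [g|g h]; first by rewrite invr_eq0.
rewrite e; have := g0 g; have := g0 h; have := g0 (g * h)%g.
move: (gamma _) (gamma _) (gamma _) (alpha _ _) => p q r w p0 q0 r0.
by field; rewrite p0 q0 r0.
Qed.

Lemma factor_set_equiv_trans alpha beta delta :
  factor_set_equiv alpha beta -> factor_set_equiv beta delta ->
  factor_set_equiv alpha delta.
Proof.
move=> [c [c0 e]] [d [d0 e']]; exists (fun g => c g * d g).
split=> [g|g h]; first by rewrite mulf_neq0.
rewrite e' e invfM; move: (c _)^-1 (d _)^-1 (c g) (c h) (d g) (d h) (alpha _ _).
by move=> *; ring.
Qed.

Lemma factor_set_equiv_factor_set alpha beta :
  factor_set alpha -> factor_set_equiv alpha beta -> factor_set beta.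
Proof.
move=> [a0 ea] [c [c0 e]].
split=> [g h|g h k]; first by rewrite e !mulf_neq0 // invr_eq0.
rewrite !e mulgA.
(* Both sides of the identity for [beta] are the corresponding sides for [alpha] times this common
   factor in [c]. *)
transitivity (c g * c h * c k / c (g * h * k)%g * (alpha g h * alpha (g * h)%g k)).
  have := c0 (g * h)%g; have := c0 (g * h * k)%g.
  by move: (c (g * h * k)%g) (c (g * h)%g) => p q p0 q0; field; rewrite p0 q0.
rewrite ea; have := c0 (h * k)%g; have := c0 (g * h * k)%g.
by move: (c (g * h * k)%g) (c (h * k)%g) => p q p0 q0; field; rewrite p0 q0.
Qed.

(** At [(x, x^-1 * y)] the coboundary of [c] is [c x / c y * c (x^-1 * y)]: conjugation by the
    diagonal of [c^-1] combined with rescaling by [c]. *)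
Lemma factor_set_mx_equiv alpha beta :
  factor_set_equiv alpha beta ->
  weight_equiv (factor_set_mx alpha) (factor_set_mx beta).
Proof.
move=> [c [c0 e]]; apply/weight_equivP.
exists (fun x => (c x)^-1), c, 1%g; split=> [x|//|x y]; first by rewrite invr_eq0.
rewrite !entry_mxG e !mul1g mulKVg invrK; congr (_ * _).
by rewrite mulrAC.
Qed.

(** The values of [a] cancel, those of [c] form a coboundary, and the translation only moves the
    base point from 1 to [t], where the ratio of [W] is the same. *)
Lemma weight_factor_equiv W V : no_zero_entry W -> is_weight W ->
  weight_equiv W V -> factor_set_equiv (weight_factor W) (weight_factor V).
Proof.
move=> nzW wW /weight_equivP[a [c [t [a0 c0 r]]]]; exists c; split=> // g h.
have e := weight_factorP nzW wW g h t.
have w0 := (no_zero_entryP W).1 nzW t (t * g * h)%g.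
have a10 := a0 1%g; have ag0 := a0 g; have agh0 := a0 (g * h)%g.
have cgh0 := c0 (g * h)%g.
rewrite [LHS]/weight_factor !r !mulg1 invg1 !mul1g mulKg mulgA.
transitivity (c g * c h / c (g * h)%g * (entry W t (t * g)%g
  * entry W (t * g)%g (t * g * h)%g / entry W t (t * g * h)%g)).
  by field; rewrite w0 a10 ag0 agh0 cgh0.
by rewrite e mulfK.
Qed.

Lemma factor_set_mx_weight_factor W : no_zero_entry W ->
  weight_equiv (factor_set_mx (weight_factor W)) W.
Proof.
move=> /no_zero_entryP W0; apply/weight_equivP.
exists (entry W 1%g), (fun=> 1), 1%g; split=> // [g|x y]; first exact: oner_neq0.
rewrite !mul1g entry_mxG /weight_factor mulKVg mulr1.
by field; rewrite !W0.
Qed.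

(** * H-weights and H-equivalence *)

Lemma hermsymmx_entryP W :
  W \is hermsymmx <-> forall x y, entry W x y = Num.conj (entry W y x).
Proof.
split=> [/is_hermitianmxP eW x y|eW].
  by rewrite {1}eW /entry expr0 scale1r !mxE.
apply/is_hermitianmxP; apply: entry_inj => x y.
by rewrite eW /entry expr0 scale1r !mxE.
Qed.

Lemma Hweight_norm1 W : is_Hweight W -> no_zero_entry W ->
  forall x y, `|entry W x y| = 1.
Proof.
move=> [_ [_ W01 _]] /no_zero_entryP W0 x y.
by case: (W01 x y) => // /eqP; rewrite normr_eq0 (negPf (W0 x y)).
Qed.

Lemma Hweight_mul_converse W : is_Hweight W -> no_zero_entry W ->
  forall x y, entry W x y * entry W y x = 1.
Proof.
move=> HW nzW x y; have W1 := Hweight_norm1 HW nzW.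
have [_ [/hermsymmx_entryP hW _ _]] := HW.
by rewrite [X in _ * X]hW -normCK W1 expr1n.
Qed.

(* Dividing [a] and [gamma] by their norms does not change the rescaling, as the
   norms cancel in every entry; hermitian symmetry then gives the condition on
   inverses. *)
Lemma weight_equiv_Hweight_equiv W V :
  is_Hweight W -> no_zero_entry W -> is_Hweight V -> no_zero_entry V ->
  weight_equiv W V -> Hweight_equiv W V.
Proof.
move=> HW nzW HV nzV /weight_equivP[a [c [t [a0 c0 r]]]].
have sgn1 (z : C) : z != 0 -> `|z / `|z| | = 1.
  by move=> z0; rewrite normrM normfV normr_id divff // normr_eq0.
have W1 := Hweight_norm1 HW nzW; have V1 := Hweight_norm1 HV nzV.
have norm_acc x y : `|a x|^-1 * `|a y| * `|c (x^-1 * y)%g| = 1.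
  by rewrite -(V1 x y) r !normrM W1 mulr1 normfV.
pose a' x := a x / `|a x|; pose c' g := c g / `|c g|.
have r' : rescaling a' c' t W V.
  move=> x y; rewrite r; congr (_ * _).
  rewrite -[LHS]mulr1 -[X in _ * X]invr1 -(norm_acc x y) /a' /c' !invfM !invrK.
  by ring.
apply/Hweight_equivP; exists a', c', t; split=> // [x|g|g].
- exact: sgn1.
- exact: sgn1.
apply: (mulfI (norm1_neq0 (sgn1 _ (c0 g)))); rewrite divff ?norm1_neq0 ?sgn1 //.
(* Multiplying the entries of [V] at [(1, g)] and [(g, 1)] cancels [a'] and the entries of [W],
   leaving [c' g * c' g^-1 = 1]. *)
have W1g := Hweight_mul_converse HW nzW t (t * g)%g.
have := Hweight_mul_converse HV nzV 1%g g.
rewrite !r' invg1 mul1g !mulg1.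
have a1 x : a' x != 0 by apply/norm1_neq0/sgn1.
have a10 := a1 1%g; have ag0 := a1 g.
rewrite mulrACA W1g mulr1 => <-; rewrite -/(c' g).
by field; rewrite a10 ag0.
Qed.

(** * Normalisation of factor sets *)

(* The product of the cocycle identities over the third variable makes
   [alpha ^ #|G|] the coboundary of [g |-> \prod_k alpha g k]; dividing by
   #|G|-th roots of this function leaves values that are roots of unity. *)
Lemma factor_set_equiv_norm1 alpha : factor_set alpha ->
  exists2 beta, factor_set_equiv alpha beta & forall g h, `|beta g h| = 1.
Proof.
move=> [a0 ea]; have n0 : (0 < #|G|)%N by apply/card_gt0P; exists 1%g.
pose f g := \prod_k alpha g k.
have f0 g : f g != 0 by apply/prodf_neq0.
have fM g h : alpha g h ^+ #|G| * f (g * h)%g = f g * f h.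
  have -> : alpha g h ^+ #|G| = \prod_(k : G) alpha g h by rewrite prodr_const.
  rewrite -big_split /= (eq_bigr _ (fun k _ => ea g h k)) big_split /=.
  congr (_ * _).
  by rewrite [RHS](reindex_inj (mulgI h)).
have [c cn] : exists c : G -> C, forall g, c g ^+ #|G| = (f g)^-1.
  by exists (fun g => (#|G|.-root (f g))^-1) => g; rewrite exprVn rootCK.
have c0 g : c g != 0.
  by have := expf_eq0 (c g) #|G|; rewrite n0 cn invr_eq0 (negPf (f0 g)) /= => <-.
exists (fun g h => c g * c h / c (g * h)%g * alpha g h); first by exists c.
move=> g h; apply/eqP; rewrite -(pexpr_eq1 n0) // -normrX !exprMn exprVn !cn invrK.
rewrite -mulrA [f _ * _]mulrC fM -invfM mulVf ?normr1 //.
by rewrite mulf_neq0.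
Qed.

Lemma factor_set_1l alpha : factor_set alpha ->
  forall g, alpha 1%g g = alpha 1%g 1%g.
Proof.
move=> [a0 ea] g; apply: (mulIf (a0 1%g g)).
by have := ea 1%g 1%g g; rewrite !mul1g.
Qed.

Lemma factor_set_1r alpha : factor_set alpha ->
  forall g, alpha g 1%g = alpha 1%g 1%g.
Proof.
move=> [a0 ea] g; apply: (mulfI (a0 g 1%g)).
by have := ea g 1%g 1%g; rewrite !mulg1.
Qed.

(** The cocycle identity for [(g, g^-1, g)]. It lets a square root of [alpha 1 1 * alpha g g^-1] be
    chosen equally at [g] and [g^-1]. *)
Lemma factor_set_invC alpha : factor_set alpha ->
  forall g, alpha g^-1%g g = alpha g g^-1%g.
Proof.
move=> fa g; have [a0 ea] := fa; apply: (mulfI (a0 1%g 1%g)).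
have := ea g g^-1%g g.
by rewrite mulgV mulVg factor_set_1l // factor_set_1r // mulrC.
Qed.

(* Square roots of [alpha 1 1 * alpha g g^-1] normalise the values at pairs
   [(g, g^-1)]; at [1] the root has to be chosen equal to [alpha 1 1]. *)
Lemma factor_set_equiv_normalized alpha : factor_set alpha ->
  (forall g h, `|alpha g h| = 1) ->
  exists2 beta, factor_set_equiv alpha beta
    & (forall g h, `|beta g h| = 1) /\ forall g, beta g g^-1%g = 1.
Proof.
move=> fa a1.
pose d g := if g == 1%g then alpha 1%g 1%g
            else sqrtC (alpha 1%g 1%g * alpha g g^-1%g).
have d2 g : d g ^+ 2 = alpha 1%g 1%g * alpha g g^-1%g.
  rewrite /d; case: eqP => [->|_]; last exact: sqrtCK.
  by rewrite invg1 expr2.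
have dV g : d g^-1%g = d g.
  by rewrite /d invg_eq1 invgK factor_set_invC.
have d1 g : `|d g| = 1.
  by apply/eqP; rewrite -(@pexpr_eq1 _ _ 2) // -normrX d2 normrM !a1 mulr1.
have d0 g : d g != 0 by apply: norm1_neq0.
(* At [(g, g^-1)] this is [d 1 * alpha g g^-1 / d g ^+ 2], which equals 1 because
   [d 1 = alpha 1 1]. *)
exists (fun g h => (d g)^-1 * (d h)^-1 * ((d (g * h)%g)^-1)^-1 * alpha g h).
  by exists (fun g => (d g)^-1); split=> // g; rewrite invr_eq0.
split=> [g h|g]; first by rewrite !normrM !normfV !d1 a1 !invr1 !mulr1.
rewrite dV mulgV invrK -invfM -expr2 d2 /d eqxx -mulrA mulVf //.
by apply: mulf_neq0; apply: norm1_neq0.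
Qed.

Lemma factor_set_mx_Hweight alpha : factor_set alpha ->
  (forall g h, `|alpha g h| = 1) -> (forall g, alpha g g^-1%g = 1) ->
  is_Hweight (factor_set_mx alpha).
Proof.
move=> fa a1 aV; have a11 : alpha 1%g 1%g = 1 by have := aV 1%g; rewrite invg1.
split; first exact: is_weight_factor_set_mx.
split=> [|x y|x]; last 2 first.
- by right; rewrite entry_mxG.
- by rewrite entry_mxG mulVg factor_set_1r.
apply/hermsymmx_entryP => x y; rewrite !entry_mxG.
apply: (mulIf (norm1_neq0 (a1 y (y^-1 * x)%g))).
rewrite [RHS]mulrC -normCK a1 expr1n.
(* This triple shows that the entries at [(x, y)] and [(y, x)] have product 1; having norm 1, they
   are conjugate. *)
have := fa.2 x (x^-1 * y)%g (y^-1 * x)%g.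
rewrite mulKVg mulgA mulgK mulVg factor_set_1r // a11 mul1r => ->.
by rewrite -[(y^-1 * x)%g]invgK invMg invgK aV.
Qed.

(** Surjectivity of [Psi]: the factor set of [W] is replaced by a unimodular one, then by a
    normalised one, whose matrix is the required H-weight. *)
Lemma weight_equiv_Hweight W : no_zero_entry W -> is_weight W ->
  exists2 V, is_Hweight V /\ no_zero_entry V & weight_equiv V W.
Proof.
move=> nzW wW; have fa := factor_set_weight_factor nzW wW.
have [beta ab b1] := factor_set_equiv_norm1 fa.
have fb := factor_set_equiv_factor_set fa ab.
have [delta bd [d1 dV]] := factor_set_equiv_normalized fb b1.
have fd := factor_set_equiv_factor_set fb bd.
exists (factor_set_mx delta).
  by split; [apply: factor_set_mx_Hweight|apply: no_zero_factor_set_mx].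
apply: weight_equiv_trans (factor_set_mx_weight_factor nzW).
apply: weight_equiv_sym; apply: factor_set_mx_equiv.
exact: factor_set_equiv_trans ab bd.
Qed.

End Weights.

Theorem theorem3p3 (R : realType) (G : finGroupType) :
  exists (Phi : set (G -> G -> R[i]%C) -> set (MG R G))
         (Psi : set (MG R G) -> set (MG R G)),
    [/\ forall alpha : G -> G -> R[i]%C, factor_set alpha ->
          [/\ is_weight (factor_set_mx alpha),
              no_zero_entry (factor_set_mx alpha)
            & Phi (factor_class alpha) = weight_class (factor_set_mx alpha)],
        set_bij (H2 R G) (weight_classes R G) Phi,
        forall W : MG R G, is_Hweight W -> no_zero_entry W ->
          Psi (Hweight_class W) = weight_class W
      & set_bij (Hweight_classes R G) (weight_classes R G) Psi].
Proof.
have [Phi PhiE bijPhi] : exists2 Phi : set (G -> G -> R[i]%C) -> set (MG R G),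
    forall alpha, factor_set alpha ->
      Phi (factor_class alpha) = weight_class (factor_set_mx alpha)
    & set_bij (H2 R G) (weight_classes R G) Phi.
  apply: (eqclass_bij (@factor_set_equiv_refl R G) (@factor_set_equiv_sym R G)
    (@factor_set_equiv_trans R G) (@weight_equiv_refl R G)
    (@weight_equiv_sym R G) (@weight_equiv_trans R G)).
  - by [].
  - by move=> W [].
  - move=> alpha fa; split; first exact: is_weight_factor_set_mx.
    exact: no_zero_factor_set_mx.
  - by move=> alpha beta _ _; apply: factor_set_mx_equiv.
  (* Injectivity of [Phi]: a factor set is recovered from its matrix by [weight_factor]. *)
  - move=> alpha beta fa fb /weight_factor_equiv.
    move=> /(_ (no_zero_factor_set_mx fa) (is_weight_factor_set_mx fa)).
    move=> [c [c0 e]]; exists c; split=> // g h.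
    by have := e g h; rewrite !weight_factor_factor_set_mx.
  - move=> W [wW nzW]; exists (weight_factor W).
      exact: factor_set_weight_factor.
    exact: factor_set_mx_weight_factor.
have [Psi PsiE bijPsi] : exists2 Psi : set (MG R G) -> set (MG R G),
    forall W, is_Hweight W /\ no_zero_entry W ->
      Psi (Hweight_class W) = weight_class W
    & set_bij (Hweight_classes R G) (weight_classes R G) Psi.
  (* [Psi] is induced by the identity on matrices. *)
  apply: (eqclass_bij (f := id) (@Hweight_equiv_refl R G)
    (@Hweight_equiv_sym R G) (@Hweight_equiv_trans R G)
    (@weight_equiv_refl R G) (@weight_equiv_sym R G) (@weight_equiv_trans R G)).
  - by move=> W [].
  - by move=> W [].
  - by move=> W [[wW _] nzW].
  - by move=> W V _ _; apply: Hweight_equiv_weight_equiv.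
  - by move=> W V [HW nzW] [HV nzV]; apply: weight_equiv_Hweight_equiv.
  - by move=> W [wW nzW]; apply: weight_equiv_Hweight.
exists Phi, Psi; split=> // [alpha fa|W HW nzW]; last exact: PsiE.
split; [exact: is_weight_factor_set_mx|exact: no_zero_factor_set_mx|exact: PhiE].
Qed.
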